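(* Let $A_S$ be a parabolic-retractable Artin group (associated to a Coxeter matrix over a finite set $S$) and let $X\subseteq S$. Then there exists an ordinary retraction $\varphi:A_S\to A_X$.
   Context: A Coxeter matrix over a finite set $S$ is a matrix $M=(m_{s,t})_{s,t\in S}$ with entries in $\mathbb{N}\cup\{\infty\}$, $m_{s,s}=1$, and $m_{s,t}=m_{t,s}\ge 2$ for $s\neq t$. Write $\Pi(s,t,m)$ for the alternating word $sts\cdots$ of length $m$. The Artin group of $M$ is $A_S=\langle S\mid \Pi(s,t,m_{s,t})=\Pi(t,s,m_{s,t})$ for $s\neq t$, $m_{s,t}\neq\infty\rangle$. For $X\subseteq S$, $A_X$ is the subgroup generated by $X$. A retraction of $G$ onto a subgroup $H$ is a homomorphism $\varphi:G\to H$ with $\varphi|_H=\mathrm{id}_H$. $A_S$ is parabolic-retractable if it admits a retraction onto $A_X$ for every $X\subseteq S$. A retraction $\varphi:A_S\to A_X$ is ordinary if $\varphi(x)=x$ for every $x\in X$ and $\varphi(y)\in X\cup\{1\}$ for every $y\in S\setminus X$. *)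

(* Defs.v *)
(* Artin groups presented as words modulo the
   congruence generated by free cancellation and the Artin relations
   (setoid presentation; the word problem is not decidable in general, so no
   quotient type is built). *)
From mathcomp Require Import all_boot.
Set Implicit Arguments. Unset Strict Implicit. Unset Printing Implicit Defensive.

Section Artin.
Variable S : finType.

(* Coxeter matrix: None stands for infinity. *)
Definition coxeter_matrix (M : S -> S -> option nat) : Prop :=
  (forall s, M s s = Some 1) /\
  (forall s t, M s t = M t s) /\
  (forall s t k, s != t -> M s t = Some k -> 2 <= k).

(* letters: (s, true) = s, (s, false) = s^-1 *)
Definition word := seq (S * bool).

Definition alt_word (s t : S) (m : nat) : word :=
  mkseq (fun i => (if odd i then t else s, true)) m.

Inductive artin_eq (M : S -> S -> option nat) : word -> word -> Prop :=
| ae_refl w : artin_eq M w w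
| ae_sym u v : artin_eq M u v -> artin_eq M v u
| ae_trans u v w : artin_eq M u v -> artin_eq M v w -> artin_eq M u w
| ae_cancel (u v : word) (a : S) (b : bool) :
    artin_eq M (u ++ [:: (a, b); (a, ~~ b)] ++ v) (u ++ v)
| ae_rel (u v : word) (s t : S) (k : nat) :
    s != t -> M s t = Some k ->
    artin_eq M (u ++ alt_word s t k ++ v) (u ++ alt_word t s k ++ v).

(* group multiplication is concatenation; a map on words is a group
   endomorphism of A_S if it is well defined on classes and multiplicative *)
Definition artin_hom (M : S -> S -> option nat) (phi : word -> word) : Prop :=
  (forall u v, artin_eq M u v -> artin_eq M (phi u) (phi v)) /\
  (forall u v, artin_eq M (phi (u ++ v)) (phi u ++ phi v)).

Definition in_parabolic (M : S -> S -> option nat) (X : {set S}) (w : word) : Prop :=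
  exists w' : word, all (fun l : S * bool => l.1 \in X) w' /\ artin_eq M w w'.

Definition is_retraction (M : S -> S -> option nat) (X : {set S}) (phi : word -> word) : Prop :=
  artin_hom M phi /\
  (forall w, in_parabolic M X (phi w)) /\
  (forall w, in_parabolic M X w -> artin_eq M (phi w) w).

Definition parabolic_retractable (M : S -> S -> option nat) : Prop :=
  forall X : {set S}, exists phi, is_retraction M X phi.

Definition ordinary_retraction (M : S -> S -> option nat) (X : {set S}) (phi : word -> word) : Prop :=
  is_retraction M X phi /\
  (forall x, x \in X -> artin_eq M (phi [:: (x, true)]) [:: (x, true)]) /\
  (forall y, y \notin X ->
     (exists2 z, z \in X & artin_eq M (phi [:: (y, true)]) [:: (z, true)]) \/
     artin_eq M (phi [:: (y, true)]) [::]).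
End Artin.

(* Main.v *)
(** Call s and r odd-equivalent when m_(s,r) is odd. If m_(s,r) = k is odd, then
    m_(s,t) divides k or m_(r,t) for every t (infinity being a multiple of
    everything). Granting this, odd equivalence is an equivalence relation, labels
    between distinct classes depend only on the classes, and inside a class they
    form an ultrametric for divisibility; sending y to a consistently chosen
    nearest point of X in its class, or to 1 if the class misses X, respects the
    relations.

    For the divisibility, let g in A_{s,t} be the image of r under a retraction, so
    that g satisfies a braid relation of odd length k with s. The group A_S acts on
    functions on S by transvections with coefficients +-2 cos(pi / m), and the
    coordinates s, t give a representation of A_{s,t} in SL_2(R) whose image is
    (up to sign and index two) the Hecke triangle group H_p, p = m_(s,t). There s
    is parabolic, g = d^-1 s d, and (s g)^k commutes with s. Writing c for the lower
    left entry of d, this forces c = 0, and then g = s, or that s g is elliptic of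
    trace 2 - l^2 c^2, l = 2 cos(pi / p). The orbit of the cusp is discrete enough
    to leave only c = +-1 with p odd, and then p divides k. If g = s, the
    relation between r and t yields that p divides m_(r,t). *)
Require Import Defs.
From Stdlib Require Import Reals Lra.
From HB Require Import structures.
From mathcomp Require Import all_boot zify.

Set Implicit Arguments.
Unset Strict Implicit.
Unset Printing Implicit Defensive.

(** * Alternating products in a monoid *)

Section Alternating.
Variables (T : Type) (e : T) (op : Monoid.law e).

Fixpoint altprod (x y : T) (n : nat) : T :=
  if n is n'.+1 then op x (altprod y x n') else e.

Lemma altprodD x y n m :
  altprod x y (n + m) =
  op (altprod x y n) (if odd n then altprod y x m else altprod x y m).
Proof.
elim: n x y => [|n IH] x y /=; first by rewrite Monoid.mul1m.
by rewrite IH Monoid.mulmA; case: (odd n).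
Qed.

Lemma altprodSr x y n :
  altprod x y n.+1 = op (altprod x y n) (if odd n then y else x).
Proof. by rewrite -addn1 altprodD /= !Monoid.mulm1. Qed.

Lemma altprod_double x y n :
  altprod x y (n + n) = altprod (op x y) (op x y) n.
Proof. by elim: n => //= n IH; rewrite addnS /= IH Monoid.mulmA. Qed.

End Alternating.

Lemma altprod_morph (T U : Type) (e : T) (op : Monoid.law e) (e' : U)
    (op' : Monoid.law e') (h : T -> U) x y n :
  h e = e' -> (forall a b, h (op a b) = op' (h a) (h b)) ->
  h (altprod op x y n) = altprod op' (h x) (h y) n.
Proof. by move=> h1 hM; elim: n x y => //= n IH x y; rewrite hM IH. Qed.

Lemma altcat_all (T : Type) (P : pred T) (x y : seq T) n :
  all P x -> all P y -> all P (altprod cat x y n).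
Proof. by elim: n x y => //= n IH x y hx hy; rewrite all_cat hx IH. Qed.

Local Open Scope R_scope.

(** * Chebyshev polynomials and 2x2 matrices *)

(* [cheb x n] is the Chebyshev polynomial of the second kind U_(n-1)(x/2). *)
Fixpoint cheb (x : R) (n : nat) : R :=
  if n is n1.+1 then
    if n1 is n2.+1 then x * cheb x n1 - cheb x n2 else 1
  else 0.

Lemma chebSS x n : cheb x n.+2 = x * cheb x n.+1 - cheb x n.
Proof. by []. Qed.

Lemma nat_ind2 (P : nat -> Prop) :
  P 0%N -> P 1%N -> (forall n, P n -> P n.+1 -> P n.+2) -> forall n, P n.
Proof.
move=> P0 P1 PSS n; suff: P n /\ P n.+1 by case.
by elim: n => // n [Pn Pn1]; split=> //; apply: PSS.
Qed.

Lemma cheb_cos (a : R) n : cheb (2 * cos a) n * sin a = sin (INR n * a).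
Proof.
elim/nat_ind2: n => [|| n IH0 IH1].
- by rewrite /= !Rmult_0_l sin_0.
- by rewrite /= !Rmult_1_l.
rewrite chebSS Rmult_minus_distr_r Rmult_assoc IH0 IH1 !S_INR.
have -> : (INR n + 1 + 1) * a = (INR n + 1) * a + a by ring.
have -> : INR n * a = (INR n + 1) * a - a by ring.
by rewrite sin_plus sin_minus; ring.
Qed.

Lemma chebN x n : cheb (- x) n = - (-1) ^ n * cheb x n.
Proof.
elim/nat_ind2: n => [|| n IH0 IH1]; first by rewrite /=; ring.
  by rewrite /=; ring.
by rewrite !chebSS IH0 IH1 /=; ring.
Qed.

Lemma cheb2 n : cheb 2 n = INR n.
Proof.
elim/nat_ind2: n => [|| n IH0 IH1] //.
by rewrite chebSS IH0 IH1 !S_INR; ring.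
Qed.

Lemma cheb_neq0 x n : x <= -2 -> (0 < n)%N -> cheb x n <> 0.
Proof.
move=> x2 n0.
(* With this sign one gets the values at -x >= 2, which start from 0 and increase strictly. *)
suff H m : 0 <= - (-1) ^ m * cheb x m < - (-1) ^ m.+1 * cheb x m.+1.
  case: n n0 => // n _ E; have := H n; rewrite E; lra.
elim: m => [|m IH]; first by rewrite /=; lra.
move: IH; rewrite chebSS.
have -> : (-1) ^ m.+2 = (-1) ^ m by rewrite /=; ring.
have -> : (-1) ^ m.+1 = - (-1) ^ m by rewrite /=; ring.
set a := (-1) ^ m; set b := cheb x m; set d := cheb x m.+1 => -[h1 h2].
have -> : - a * (x * d - b) = (-x) * (- - a * d) - (- a * b) by ring.
nra.
Qed.

Lemma sin_mul_eq0 (p n : nat) : (0 < p)%N ->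
  sin (INR n * (PI / INR p)) = 0 -> (p %| n)%N.
Proof.
move=> p0; have p0' : 0 < INR p by apply: lt_0_INR; lia.
case/sin_eq_0_0 => z Hz; have HPI := PI_RGT_0.
have E : INR n = IZR z * INR p.
  have -> : INR n = (INR n * (PI / INR p)) * (INR p / PI).
    by field; split; lra.
  by rewrite Hz; field; lra.
have /eq_IZR E2 : IZR (Z.of_nat n) = IZR (z * Z.of_nat p).
  by rewrite mult_IZR -!INR_IZR_INZ.
have z0 : (0 <= z)%Z by nia.
apply/dvdnP; exists (Z.to_nat z); nia.
Qed.

Section Angle.
Variable p : nat.
Hypothesis p2 : (1 < p)%N.
Let a := PI / INR p.

Lemma angle_bounds : 0 < a <= PI / 2.
Proof.
have HPI := PI_RGT_0; have p2' : 2 <= INR p by apply: (le_INR 2); lia.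
split; first by apply: Rdiv_lt_0_compat; lra.
apply: (Rmult_le_reg_r (INR p)); first lra.
by rewrite /a; have -> : PI / INR p * INR p = PI by [field; lra]; nra.
Qed.

Lemma angleK : INR p * a = PI.
Proof.
have p2' : 2 <= INR p by apply: (le_INR 2); lia.
by rewrite /a; field; lra.
Qed.

Lemma sin_angle_gt0 : 0 < sin a.
Proof. by have := PI_RGT_0; have := angle_bounds => *; apply: sin_gt_0; lra. Qed.

Lemma cheb_angle0 : cheb (2 * cos a) p = 0.
Proof.
have := cheb_cos a p; rewrite angleK sin_PI; have := sin_angle_gt0; nra.
Qed.

Lemma cheb_angle_pred : cheb (2 * cos a) p.-1 = 1.
Proof.
have := cheb_cos a p.-1.
have -> : INR p.-1 * a = PI - a.
  rewrite -[in RHS]angleK -[in RHS](ltn_predK p2) S_INR; ring.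
rewrite sin_PI_x; have := sin_angle_gt0; nra.
Qed.

Lemma cheb_angle_succ : cheb (2 * cos a) p.+1 = -1.
Proof.
have := chebSS (2 * cos a) p.-1.
by rewrite (ltn_predK p2) cheb_angle0 cheb_angle_pred => ->; ring.
Qed.

(** Since a <= i a <= PI - a, sin (i a) is at least sin a. *)
Lemma cheb_angle_ge1 i : (0 < i < p)%N -> 1 <= cheb (2 * cos a) i.
Proof.
case/andP => i0 ip; have E := cheb_cos a i; have s0 := sin_angle_gt0.
suff H : sin a <= sin (INR i * a) by rewrite -E in H; nra.
have [a0 _] := angle_bounds.
have i1 : 1 <= INR i by apply: (le_INR 1); lia.
have ip1 : INR i + 1 <= INR p by rewrite -S_INR; apply: le_INR; lia.
have aK := angleK.
suff : 0 <= sin (INR i * a) - sin a by lra.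
rewrite form4.
have h1 : 0 <= sin ((INR i * a - a) / 2) by apply: sin_ge_0; nra.
have h2 : 0 <= cos ((INR i * a + a) / 2) by apply: cos_ge_0; nra.
nra.
Qed.

Lemma cos_angle_eq0 : cos a = 0 -> p = 2%N.
Proof.
move=> c0; have HPI := PI_RGT_0; have [a0 a1] := angle_bounds.
have aE : a = PI / 2.
  case: (Rlt_le_dec a (PI / 2)) => [h|h]; last lra.
  have := @cos_gt_0 a; lra.
have : INR p = INR 2 by rewrite /=; have := angleK; rewrite aE; nra.
exact: INR_eq.
Qed.

End Angle.

Record mat := Mat { m11 : R; m12 : R; m21 : R; m22 : R }.

Definition mmul (x y : mat) : mat :=
  Mat (m11 x * m11 y + m12 x * m21 y) (m11 x * m12 y + m12 x * m22 y)
      (m21 x * m11 y + m22 x * m21 y) (m21 x * m12 y + m22 x * m22 y).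

Definition mone : mat := Mat 1 0 0 1.

Lemma mmulA : associative mmul.
Proof. by case=> ????[????][????]; rewrite /mmul /=; congr Mat; ring. Qed.
Lemma mmul1x : left_id mone mmul.
Proof. by case=> ????; rewrite /mmul /=; congr Mat; ring. Qed.
Lemma mmulx1 : right_id mone mmul.
Proof. by case=> ????; rewrite /mmul /=; congr Mat; ring. Qed.

HB.instance Definition _ := Monoid.isLaw.Build mat mone mmul mmulA mmul1x mmulx1.

Local Notation altm := (altprod mmul).

Definition mdet (x : mat) : R := m11 x * m22 x - m12 x * m21 x.
Definition mtr (x : mat) : R := m11 x + m22 x.

Lemma mdetM x y : mdet (mmul x y) = mdet x * mdet y.
Proof. by rewrite /mdet /mmul /=; ring. Qed.

Lemma mdet_alt x y n : mdet x = 1 -> mdet y = 1 -> mdet (altm x y n) = 1.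
Proof.
move=> dx dy; elim: n x y dx dy => [|n IH] x y dx dy; first by rewrite /mdet /=; ring.
by rewrite /= mdetM dx IH // Rmult_1_l.
Qed.

Lemma mmulI x y z : mdet x = 1 -> mmul x y = mmul x z -> y = z.
Proof.
case: x y z => a b c d [a1 b1 c1 d1] [a2 b2 c2 d2].
rewrite /mdet /mmul /= => D [h1 h2 h3 h4].
have K u v u' v' : a * u + b * v = a * u' + b * v' ->
    c * u + d * v = c * u' + d * v' -> u = u' /\ v = v'.
  move=> e1 e2; split; apply: Rminus_diag_uniq.
    have -> : u - u' = (a * d - b * c) * (u - u') by rewrite D; ring.
    have -> : (a * d - b * c) * (u - u') =
      d * (a * u + b * v - (a * u' + b * v')) - b * (c * u + d * v - (c * u' + d * v')) by ring.
    by rewrite e1 e2; ring.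
  have -> : v - v' = (a * d - b * c) * (v - v') by rewrite D; ring.
  have -> : (a * d - b * c) * (v - v') =
    a * (c * u + d * v - (c * u' + d * v')) - c * (a * u + b * v - (a * u' + b * v')) by ring.
  by rewrite e1 e2; ring.
by have [-> ->] := K _ _ _ _ h1 h3; have [-> ->] := K _ _ _ _ h2 h4.
Qed.

(* Cayley-Hamilton: x^n = U_(n-1) x + (U_n - tr x U_(n-1)) 1. *)
Lemma mpowE x n : mdet x = 1 ->
  let t := mtr x in
  altm x x n =
    Mat (cheb t n * m11 x + (cheb t n.+1 - t * cheb t n)) (cheb t n * m12 x)
        (cheb t n * m21 x) (cheb t n * m22 x + (cheb t n.+1 - t * cheb t n)).
Proof.
move=> D t; elim: n => [|n IH]; first by rewrite /mone /=; congr Mat; ring.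
rewrite -[altm x x n.+1]/(mmul x (altm x x n)) IH chebSS /mmul (lock n.+1) /= -lock.
have T : t = m11 x + m22 x by [].
have D' : m12 x * m21 x = m11 x * m22 x - 1 by rewrite -D /mdet; ring.
set f := cheb t n; set g := cheb t n.+1.
congr Mat; try by rewrite T; ring.
- transitivity (f * (m11 x * m11 x) + f * (m12 x * m21 x) + (g - t * f) * m11 x); first ring.
  by rewrite D' T; ring.
- transitivity (f * (m12 x * m21 x) + f * (m22 x * m22 x) + (g - t * f) * m22 x); first ring.
  by rewrite D' T; ring.
Qed.

(** * Two parabolic generators and their braid relations *)

Definition upper (l : R) : mat := Mat 1 l 0 1.
Definition lower (l : R) : mat := Mat 1 0 l 1.
(** The elliptic element u: for l = 2 cos(pi / p) its p-th power is -1. With c = [quarter], the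
    parabolic generators factor as u c and c u. *)
Definition rot (l : R) : mat := Mat l (-1) 1 0.
Definition quarter : mat := Mat 0 1 (-1) 0.

Lemma upper_rot l : upper l = mmul (rot l) quarter.
Proof. by rewrite /upper /mmul /=; congr Mat; ring. Qed.

Lemma lower_rot l : lower (- l) = mmul quarter (rot l).
Proof. by rewrite /lower /mmul /=; congr Mat; ring. Qed.

Lemma mpow_rot l n : altm (rot l) (rot l) n =
  Mat (cheb l n.+1) (- cheb l n) (cheb l n) (cheb l n.+1 - l * cheb l n).
Proof.
have T : mtr (rot l) = l by rewrite /mtr /=; ring.
rewrite mpowE; last by rewrite /mdet /=; ring.
by rewrite T /=; congr Mat; ring.
Qed.

(** As [quarter] squares to the central -1, the factors u collect: the products are u^(n+1) c^(n+1)
    and c u^(n+1) c^n. *)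
Lemma alt_upper_lower l n :
  altm (upper l) (lower (- l)) n.+1 =
    mmul (altm (rot l) (rot l) n.+1) (mmul quarter (altm quarter quarter n)) /\
  altm (lower (- l)) (upper l) n.+1 =
    mmul (mmul quarter (altm (rot l) (rot l) n.+1)) (altm quarter quarter n).
Proof.
rewrite upper_rot lower_rot; elim: n => [|n [IHX IHY]].
  by rewrite /= !mmulx1.
split.
- rewrite (lock n.+1) /= -lock IHY.
  set P := altm (rot l) (rot l) n.+1 => /=; set Q := altm _ _ n.
  have K2 w : mmul quarter (mmul quarter w) = Mat (- m11 w) (- m12 w) (- m21 w) (- m22 w).
    by rewrite /mmul /=; congr Mat; ring.
  rewrite -!mmulA /= !K2.
  by rewrite /mmul /=; congr Mat; ring.
- rewrite (lock n.+1) /= -lock IHX.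
  by set P := altm (rot l) (rot l) n.+1 => /=; rewrite !mmulA.
Qed.

Lemma alt_upper_lower_comm l n : cheb l n = 0 ->
  altm (upper l) (lower (- l)) n = altm (lower (- l)) (upper l) n.
Proof.
case: n => // n l0; have [-> ->] := alt_upper_lower l n.
rewrite mmulA; congr mmul; rewrite mpow_rot l0.
by rewrite /mmul /=; congr Mat; ring.
Qed.

(** The relation says that u^n commutes with c. But u^n is [cheb l n] times u plus a scalar, and u
    does not commute with c when l <> 0. *)
Lemma alt_upper_lower_cheb0 l n : l <> 0 ->
  altm (upper l) (lower (- l)) n = altm (lower (- l)) (upper l) n -> cheb l n = 0.
Proof.
case: n => // n l0; have [-> ->] := alt_upper_lower l n; rewrite mpow_rot.
set Q := altm _ _ n => E.
have detQ : mdet Q = 1 by apply: mdet_alt; rewrite /mdet /=; ring.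
move: E detQ; set f := cheb l n.+1; set g := cheb l n.+2.
case: Q => a b c d; rewrite /mdet /mmul /= => -[h1 h2 h3 h4] D.
have e1 : l * f * a = 0 by lra.
have e2 : l * f * b = 0 by lra.
have e3 : l * f * c = 0 by lra.
have : l * f * (a * d - b * c) = 0.
  transitivity (l * f * a * d - l * f * b * c); first ring.
  by rewrite e1 e2; ring.
rewrite D Rmult_1_r; case/Rmult_integral => //.
Qed.

(** Here d is the Garside element: for odd k it conjugates x and y into each other. *)
Lemma odd_braid_conj x y k : odd k -> altm x y k = altm y x k ->
  let d := altm x y k in
  [/\ mmul x d = mmul d y, mmul d x = mmul y d
    & mmul d d = altm (mmul x y) (mmul x y) k].
Proof.
move=> ok E d; split.
- by rewrite {1}/d E -[LHS]/(altm x y k.+1) altprodSr ok.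
- by rewrite {1}/d E -[RHS]/(altm y x k.+1) altprodSr ok.
- by rewrite {2}/d E -altprod_double altprodD ok.
Qed.

Lemma braid_upper_cases l g k : l <> 0 -> odd k ->
  mdet g = 1 -> altm (upper l) g k = altm g (upper l) k ->
  let c := m21 (altm (upper l) g k) in
  (c = 0 -> g = upper l) /\ (c <> 0 -> cheb (2 - l ^ 2 * c ^ 2) k = 0).
Proof.
move=> l0 ok dg E c.
have [h1 h2 h3] := odd_braid_conj ok E.
have dA : mdet (upper l) = 1 by rewrite /mdet /=; ring.
have dD := mdet_alt k dA dg.
move: h1 h2 h3 dD; rewrite /c; set d := altm _ _ _ => h1 h2 h3 dD {c}.
have hc : mmul (upper l) (mmul d d) = mmul (mmul d d) (upper l).
  by rewrite mmulA h1 -mmulA -h2 mmulA.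
split=> c0.
  (* With d upper triangular, g is upper unipotent. Then so is d, a product of copies of [upper l]
     and g, and it commutes with [upper l]. *)
  have [g11 g21 g22] : [/\ m11 g = 1, m21 g = 0 & m22 g = 1].
    move: h1 dD; rewrite /mdet /mmul /= c0 => -[e1 e2 e3 e4] D.
    have D' : m11 d * m22 d = 1 by lra.
    have d22 : m22 d <> 0 by move=> Z; move: D'; rewrite Z; lra.
    have d11 : m11 d <> 0 by move=> Z; move: D'; rewrite Z; lra.
    have g21 : m21 g = 0 by apply: (Rmult_eq_reg_l (m22 d)) => //; lra.
    rewrite g21 in e1; split=> //.
      by apply: (Rmult_eq_reg_l (m11 d)) => //; lra.
    by apply: (Rmult_eq_reg_l (m22 d)) => //; lra.
  have gU : g = upper (m12 g) by case: (g) g11 g21 g22 => ???? /= -> -> ->.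
  have altU x y n : exists z, altm (upper x) (upper y) n = upper z.
    elim: n x y => [|n IH] x y; first by exists 0.
    have [z /= ->] := IH y x; exists (x + z).
    by rewrite /mmul /upper /=; congr Mat; ring.
  have [z Ez] : exists z, d = upper z by rewrite /d gU; apply: altU.
  apply: (mmulI dD); rewrite -h1 Ez /mmul /=; congr Mat; ring.
(* Read off from d g = (upper l) d; the second quantity is the trace of (upper l) g. *)
have gE : m21 g = - l * m21 d ^ 2 /\ m11 g + l * m21 g + m22 g = 2 - l ^ 2 * m21 d ^ 2.
  move: h1 dD; rewrite /mdet /mmul /= => -[e1 e2 e3 e4] D.
  have r21 : m21 g = - l * m21 d ^ 2.
    transitivity ((m11 d * m22 d - m12 d * m21 d) * m21 g); first by rewrite D; ring.
    transitivity (m11 d * (m21 d * m11 g + m22 d * m21 g)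
                  - m21 d * (m11 d * m11 g + m12 d * m21 g)); first ring.
    by rewrite -e1 -e3; ring.
  have r11 : m11 g = 1 + l * (m21 d * m22 d).
    transitivity ((m11 d * m22 d - m12 d * m21 d) * m11 g); first by rewrite D; ring.
    transitivity (m22 d * (m11 d * m11 g + m12 d * m21 g)
                  - m12 d * (m21 d * m11 g + m22 d * m21 g)); first ring.
    transitivity ((m11 d * m22 d - m12 d * m21 d) + l * (m21 d * m22 d)).
      by rewrite -e1 -e3; ring.
    by rewrite D.
  have r22 : m22 g = 1 - l * (m21 d * m22 d).
    transitivity ((m11 d * m22 d - m12 d * m21 d) * m22 g); first by rewrite D; ring.
    transitivity (m11 d * (m21 d * m12 g + m22 d * m22 g)
                  - m21 d * (m11 d * m12 g + m12 d * m22 g)); first ring.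
    transitivity ((m11 d * m22 d - m12 d * m21 d) - l * (m21 d * m22 d)).
      by rewrite -e2 -e4; ring.
    by rewrite D.
  by split=> //; rewrite r11 r22 r21; ring.
have dv : mdet (mmul (upper l) g) = 1 by rewrite mdetM dA dg Rmult_1_l.
have tv : mtr (mmul (upper l) g) = 2 - l ^ 2 * m21 d ^ 2.
  by rewrite -gE.2 /mtr /mmul /=; ring.
(* By Cayley-Hamilton d^2 is f times (upper l) g plus a scalar. The upper left entry of its
   commutator with [upper l] is, up to sign, f l^2 c^2. *)
move: hc; rewrite h3 (mpowE k dv) tv.
set f := cheb _ k; set q := cheb _ k.+1.
rewrite /mmul /= gE.1 => -[e1 _ _ _].
have : f * (l * (l * (m21 d * m21 d))) = 0 by lra.
case/Rmult_integral => // Z; exfalso; apply: c0.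
by case/Rmult_integral: Z => // /Rmult_integral[|/Rmult_integral[]].
Qed.

(** * Orbit of the cusp *)

Section Farey.
Variable p : nat.
Hypothesis p3 : (2 < p)%N.
Let l := 2 * cos (PI / INR p).
Let F := cheb l.

(* First columns of the nonnegative matrices of the Hecke triangle group,
   which up to sign are the products of the matrices [u^j c] ([0 < j < p]),
   where [u] has order [2 p] and [c] order 4. For even [p] the boolean
   is the value of the character sending both [u] and [c] to [-1], whose kernel
   contains [upper l] and [lower l]; for odd [p] it carries no information. *)
Inductive farey : bool -> R -> R -> Prop :=
| Farey10 e : (~~ odd p -> e = false) -> farey e 1 0
| Farey01 e : (~~ odd p -> e = true) -> farey e 0 1
| FareyS e e' j x y : (0 < j < p)%N -> (~~ odd p -> e' = e (+) odd j.+1) ->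
    farey e x y ->
    farey e' (F j * x + F j.+1 * y) (F j.-1 * x + F j * y).

Lemma farey_odd e e' x y : odd p -> farey e x y -> farey e' x y.
Proof.
move=> op; case=> [? _|? _|e1 e2 j u v jp _ H].
- by apply: Farey10; rewrite op.
- by apply: Farey01; rewrite op.
- by apply: FareyS jp _ H; rewrite op.
Qed.

(** One of the four quarter turns of (x, y) is a [farey] vector; each turn by [quarter] flips the
    character. *)
Definition cusp_orbit e x y : Prop :=
  [\/ farey e x y, farey e (- x) (- y), farey (~~ e) (- y) x
    | farey (~~ e) y (- x)].

Lemma cusp_orbitN e x y : cusp_orbit e x y -> cusp_orbit e (- x) (- y).
Proof.
rewrite /cusp_orbit !Ropp_involutive.
by case=> H; [apply: Or42|apply: Or41|apply: Or44|apply: Or43].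
Qed.

Lemma cusp_orbit_quarter e x y : cusp_orbit e x y -> cusp_orbit (~~ e) y (- x).
Proof.
rewrite /cusp_orbit !negbK !Ropp_involutive.
by case=> H; [apply: Or43|apply: Or44|apply: Or42|apply: Or41].
Qed.

Let p2 : (1 < p)%N. Proof. exact: ltnW. Qed.
Let F0 : F 0%N = 0. Proof. by []. Qed.
Let F1 : F 1%N = 1. Proof. by []. Qed.
Let FSS n : F n.+2 = l * F n.+1 - F n. Proof. by []. Qed.
Let Fp : F p = 0. Proof. exact: cheb_angle0 p2. Qed.
Let Fp1 : F p.-1 = 1. Proof. exact: cheb_angle_pred p2. Qed.
Let FpS : F p.+1 = -1. Proof. exact: cheb_angle_succ p2. Qed.
Let Fge1 i : (0 < i < p)%N -> 1 <= F i. Proof. exact: (@cheb_angle_ge1 p p2 i). Qed.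

Lemma cusp_orbit_rot e x y : cusp_orbit e x y -> cusp_orbit (~~ e) (l * x - y) x.
Proof.
have pos e1 x1 y1 : farey e1 x1 y1 -> cusp_orbit (~~ e1) (l * x1 - y1) x1.
  case=> [e2 H|e2 H|e2 e3 j u v /andP[j0 jp] H Q].
  - apply: Or41; have -> : l * 1 - 0 = F 1%N * 0 + F 2%N * 1 by rewrite FSS F1 F0; ring.
    rewrite [X in farey _ _ X](_ : 1 = F 0%N * 0 + F 1%N * 1); last by rewrite F1 F0; ring.
    by apply: (@FareyS true _ 1); [lia | move/H->|exact: Farey01].
  - apply: Or42; have -> : - (l * 0 - 1) = 1 by ring.
    by rewrite Ropp_0; apply: Farey10 => /H->.
  - have [n jE] : exists n, j = n.+1 by case: (j) j0 => // n _; exists n.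
    subst j; have -> : l * (F n.+1 * u + F n.+2 * v) - (F n.+1.-1 * u + F n.+1 * v)
             = F n.+2 * u + F n.+3 * v by rewrite !FSS /=; ring.
    (* u u^j c = u^(j+1) c is again of the required form unless j + 1 = p, when u^p = -1 leaves
       -c. *)
    case: (ltngtP n.+2 p) => [lt|gt|E]; [|lia|].
      apply: Or41; apply: (@FareyS e2 _ n.+2) => // /H->.
      by case: (e2) => /=; case: (odd n).
    apply: Or44; rewrite negbK.
    have -> : F n.+1 * u + F n.+2 * v = u by rewrite E Fp -[n.+1]/(n.+2.-1) E Fp1; ring.
    have -> : - (F n.+2 * u + F n.+3 * v) = v by rewrite E Fp FpS; ring.
    case op: (odd p); first exact: farey_odd op Q.
    by rewrite H ?op // E op addbF.
have neg e1 x1 y1 : farey e1 (- y1) x1 -> cusp_orbit e1 (l * x1 - y1) x1.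
  move=> Q; apply: Or41.
  have -> : l * x1 - y1 = F 1%N * (- y1) + F 2%N * x1 by rewrite FSS F1 F0; ring.
  rewrite [X in farey _ _ X](_ : x1 = F 0%N * (- y1) + F 1%N * x1); last by rewrite F1 F0; ring.
  by apply: (@FareyS e1 _ 1 _ _ _ _ Q); [lia|rewrite /= addbF].
case=> H; first exact: pos; [|exact: neg|].
  have := cusp_orbitN (pos _ _ _ H).
  by rewrite Ropp_involutive; congr cusp_orbit; ring.
have := @neg _ (- x) (- y); rewrite Ropp_involutive => /(_ _ H)/cusp_orbitN.
by rewrite Ropp_involutive; congr cusp_orbit; ring.
Qed.

Lemma cusp_orbit_even e e' x y : (~~ odd p -> e = e') ->
  cusp_orbit e x y -> cusp_orbit e' x y.
Proof.
move=> E; case: (boolP (odd p)) => [op|/E-> //].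
by case=> H; [apply: Or41|apply: Or42|apply: Or43|apply: Or44];
  apply: farey_odd op H.
Qed.

(** The inverse of u is -u^(p-1), so p - 1 forward rotations and a sign change do it. *)
Lemma cusp_orbit_rotV e x y : cusp_orbit e x y -> cusp_orbit (~~ e) y (l * y - x).
Proof.
move=> H.
have iterE n : cusp_orbit (e (+) odd n) (F n.+1 * x - F n * y)
    (F n * x + (F n.+1 - l * F n) * y).
  elim: n => [|n /cusp_orbit_rot].
    by move: H; rewrite addbF F1 F0; congr cusp_orbit; ring.
  rewrite -addbN; congr cusp_orbit; rewrite ?FSS; ring.
have := iterE p.-1; rewrite (ltn_predK p2) Fp Fp1 => /cusp_orbitN h.
apply: (@cusp_orbit_even (e (+) odd p.-1)).
  by move: (ltn_predK p2) => <- /=; rewrite negbK => ->; rewrite addbT.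
by move: h; congr cusp_orbit; ring.
Qed.

(** From (1, 0) and (0, 1) the new coordinates are values of F. From u, v >= 1 they are at least 2,
    unless j = p - 1 copies the first or j = 1 the second; for even p both keep the character. *)
Lemma farey_bound e x y : farey e x y ->
  [\/ [/\ x = 1, y = 0 & ~~ odd p -> e = false],
      [/\ x = 0, y = 1 & ~~ odd p -> e = true]
    | [/\ 1 <= x, 1 <= y, 2 <= l * x \/ x = 1 /\ (~~ odd p -> e = false)
        & 2 <= l * y \/ y = 1 /\ (~~ odd p -> e = true)]].
Proof.
have l1 : 1 <= l.
  have := @Fge1 2; rewrite FSS F1 F0 => /(_ p3); lra.
(* l F_j = F_(j-1) + F_(j+1), both terms being at least 1. *)
have lF j : (1 < j < p.-1)%N -> 2 <= l * F j.
  case: j => [|[|j]] // /andP[_ jp].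
  have := FSS j.+1; have := @Fge1 j.+1; have := @Fge1 j.+3.
  move=> /(_ ltac:(lia)) h1 /(_ ltac:(lia)) h2 h3; lra.
elim=> [? H|? H|e1 e2 j u v /andP[j0 jp] H Q IH]; [by apply: Or31|by apply: Or32|].
have jcase : j = p.-1 \/ (j.+1 < p)%N by lia.
have j1case : j = 1%N \/ (1 < j)%N by lia.
have Fj : 1 <= F j by apply: Fge1; lia.
have oddp1 : ~~ odd p -> odd p.-1 by rewrite -{1}(ltn_predK p2) /= negbK.
case: IH => [[-> -> c]|[-> -> c]|[u1 v1 hu hv]].
- have -> : F j * 1 + F j.+1 * 0 = F j by ring.
  have -> : F j.-1 * 1 + F j * 0 = F j.-1 by ring.
  case: j1case => [j1|j1].
    by apply: Or31; rewrite j1 F1 F0; split=> // op; rewrite H // c // j1.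
  apply: Or33; split=> //; first by apply: Fge1; lia.
    case: jcase => [jE|jE]; [right|left; apply: lF; lia].
    rewrite jE Fp1; split=> // op; rewrite H // c // jE (ltn_predK p2).
    exact: negbTE.
  case: (ltngtP j 2) => [|j2|jE]; [lia|left; apply: lF; lia|right].
  by rewrite jE F1; split=> // op; rewrite H // c // jE.
- have -> : F j * 0 + F j.+1 * 1 = F j.+1 by ring.
  have -> : F j.-1 * 0 + F j * 1 = F j by ring.
  case: jcase => [jE|jE].
    apply: Or32; rewrite jE (ltn_predK p2) Fp Fp1; split=> // op.
    by rewrite H // c // jE (ltn_predK p2) (negbTE op).
  apply: Or33; split=> //; first by apply: Fge1; lia.
    have [jE'|jE'] : j.+1 = p.-1 \/ (j.+1 < p.-1)%N by lia.
      by right; rewrite jE' Fp1; split=> // op; rewrite H // c // jE' oddp1.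
    by left; apply: lF; lia.
  case: j1case => [j1|j1]; last by left; apply: lF; lia.
  by right; rewrite j1 F1; split=> // op; rewrite H // c // j1.
- have hx : j = p.-1 \/ 2 <= F j * u + F j.+1 * v.
    case: jcase => [jE|jE]; [by left|right].
    have : 1 <= F j.+1 by apply: Fge1; lia.
    nra.
  have hy : j = 1%N \/ 2 <= F j.-1 * u + F j * v.
    case: j1case => [jE|jE]; [by left|right].
    have : 1 <= F j.-1 by apply: Fge1; lia.
    nra.
  apply: Or33; split.
  + case: hx => [jE|]; last lra.
    by rewrite jE (ltn_predK p2) Fp Fp1; lra.
  + case: hy => [jE|]; last lra.
    by rewrite jE F1 F0; lra.
  + case: hx => [jE|hx]; last by left; nra.
    have -> : F j * u + F j.+1 * v = u by rewrite jE (ltn_predK p2) Fp Fp1; ring.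
    case: hu => [|[u1' hu]]; [by left|right; split=> // op].
    by rewrite H // hu // jE (ltn_predK p2) (negbTE op).
  + case: hy => [jE|hy]; last by left; nra.
    have -> : F j.-1 * u + F j * v = v by rewrite jE F1 F0; ring.
    case: hv => [|[v1' hv]]; [by left|right; split=> // op].
    by rewrite H // hv // jE.
Qed.

(** Up to sign, y is the second coordinate of a [farey] vector of character [false] or the first of
    one of character [true]. For even p, a coordinate 1 in that place forces the opposite
    character. *)
Lemma cusp_orbit_bound x y : cusp_orbit false x y ->
  [\/ y = 0, 2 <= l * Rabs y | y ^ 2 = 1 /\ odd p].
Proof.
have B z : 0 <= z -> [\/ z = 0, 2 <= l * z | z ^ 2 = 1 /\ odd p] ->
    y = z \/ y = - z -> [\/ y = 0, 2 <= l * Rabs y | y ^ 2 = 1 /\ odd p].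
  move=> z0 Hz yz.
  have -> : Rabs y = z by case: yz => ->; rewrite ?Rabs_Ropp Rabs_right; lra.
  have -> : y ^ 2 = z ^ 2 by case: yz => ->; ring.
  case: Hz => [z00|?|?]; [apply: Or31|exact: Or32|exact: Or33].
  by case: yz => ->; rewrite z00; ring.
have first e u v : farey e u v -> e -> 0 <= u /\ [\/ u = 0, 2 <= l * u | u ^ 2 = 1 /\ odd p].
  move/farey_bound => + et; case=> [[-> _ c]|[-> _ c]|[u1 _ h _]].
  - split; first lra; apply: Or33; split; first ring.
    by apply/negPn/negP => /c; rewrite et.
  - by split; [lra|apply: Or31].
  - split; first lra; case: h => [|[-> c]]; first exact: Or32.
    apply: Or33; split; first ring.
    by apply/negPn/negP => /c; rewrite et.
have second e u v : farey e u v -> ~~ e -> 0 <= v /\ [\/ v = 0, 2 <= l * v | v ^ 2 = 1 /\ odd p].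
  move/farey_bound => + et; case=> [[_ -> c]|[_ -> c]|[_ v1 _ h]].
  - by split; [lra|apply: Or31].
  - split; first lra; apply: Or33; split; first ring.
    by apply/negPn/negP => /c; apply/negP.
  - split; first lra; case: h => [|[-> c]]; first exact: Or32.
    apply: Or33; split; first ring.
    by apply/negPn/negP => /c; apply/negP.
case=> H.
- by have [h0 h] := second _ _ _ H isT; apply: (B y) => //; left.
- by have [h0 h] := second _ _ _ H isT; apply: (B (- y)) => //; right; ring.
- by have [h0 h] := first _ _ _ H isT; apply: (B (- y)) => //; right; ring.
- by have [h0 h] := first _ _ _ H isT; apply: (B y) => //; left.
Qed.

End Farey.

(** * Matrices of words in two generators *)

Definition letter_mat (T : eqType) (a : T) (l : R) (x : T * bool) : mat :=
  let y := if x.2 then l else - l in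
  if x.1 == a then upper y else lower (- y).

(** Meant for words in [a] and one other letter: all letters different from [a] get the same
    matrix. *)
Definition word_mat (T : eqType) (a : T) (l : R) (w : seq (T * bool)) : mat :=
  foldr (fun x => mmul (letter_mat a l x)) mone w.

Lemma word_mat_cat (T : eqType) (a : T) l u v :
  word_mat a l (u ++ v) = mmul (word_mat a l u) (word_mat a l v).
Proof. by elim: u => [|x u IH] /=; rewrite ?mmul1x // IH mmulA. Qed.

Lemma word_mat_det (T : eqType) (a : T) l w : mdet (word_mat a l w) = 1.
Proof.
elim: w => [|x w IH]; first by rewrite /mdet /=; ring.
rewrite /= mdetM IH /letter_mat /mdet; case: ifP => _ /=; ring.
Qed.

Lemma word_mat_alt (T : eqType) (a : T) l x y n :
  word_mat a l (altprod cat x y n) = altm (word_mat a l x) (word_mat a l y) n.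
Proof. by apply: altprod_morph => // u v; exact: word_mat_cat. Qed.

Lemma word_mat_upper (T : eqType) (a : T) l : word_mat a l [:: (a, true)] = upper l.
Proof. by rewrite /= mmulx1 /letter_mat eqxx. Qed.

Lemma word_mat_lower (T : eqType) (a b : T) l : b != a ->
  word_mat a l [:: (b, true)] = lower (- l).
Proof. by move=> ba; rewrite /= mmulx1 /letter_mat (negbTE ba). Qed.

(** The first column is the image of the cusp (1, 0). Each letter is u c or c u up to inversion, so
    it flips the character twice. *)
Lemma word_mat_cusp (T : eqType) (a : T) p w : (2 < p)%N ->
  let l := 2 * cos (PI / INR p) in let g := word_mat a l w in
  cusp_orbit p false (m11 g) (m21 g).
Proof.
move=> p3 l /=; elim: w => [|[b s] w IH]; first by apply: Or41; apply: Farey10.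
rewrite /=; set x := m11 _ in IH *; set y := m21 _ in IH *.
rewrite /letter_mat; case: ifP => _; case: s => /=.
- have := cusp_orbit_rot p3 (cusp_orbit_quarter IH).
  by congr cusp_orbit; rewrite -/l; ring.
- have := cusp_orbitN (cusp_orbit_quarter (cusp_orbit_rotV p3 IH)).
  by congr cusp_orbit; rewrite -/l; ring.
- have := cusp_orbit_quarter (cusp_orbit_rot p3 IH).
  by congr cusp_orbit; rewrite -/l; ring.
- have := cusp_orbitN (cusp_orbit_rotV p3 (cusp_orbit_quarter IH)).
  by congr cusp_orbit; rewrite -/l; ring.
Qed.

(** For the label infinity, of weight 2, parity replaces the orbit argument. *)
Lemma word_mat2 (T : eqType) (a : T) w : let g := word_mat a 2 w in
  exists m n : Z, m11 g = IZR m /\ m21 g = 2 * IZR n.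
Proof.
elim: w => [|[b s] w [m [n [Em En]]]]; first by exists 1%Z, 0%Z => /=; split; ring.
move=> /=; rewrite Em En /letter_mat; case: ifP => _; case: s => /=.
- by exists (m + 4 * n)%Z, n; rewrite plus_IZR mult_IZR; split; ring.
- by exists (m - 4 * n)%Z, n; rewrite minus_IZR mult_IZR; split; ring.
- by exists m, (n - m)%Z; rewrite minus_IZR; split; ring.
- by exists m, (n + m)%Z; rewrite plus_IZR; split; ring.
Qed.

(** * Words and homomorphisms *)

Section Words.
Variables (S : finType) (M : S -> S -> option nat).
Implicit Types (u v w x y : word S) (a b s t : S).

Lemma artin_eq_ctx x u v y :
  artin_eq M u v -> artin_eq M (x ++ u ++ y) (x ++ v ++ y).
Proof.
elim=> {u v} [w|u v _ IH|u v w _ IH1 _ IH2|u v a b|u v s t k st Mk].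
- exact: ae_refl.
- exact: ae_sym.
- exact: ae_trans IH1 IH2.
- by have := ae_cancel M (x ++ u) (v ++ y) a b; rewrite -!catA.
- by have := ae_rel (x ++ u) (v ++ y) st Mk; rewrite -!catA.
Qed.

Lemma artin_eq_cat u u' v v' :
  artin_eq M u u' -> artin_eq M v v' -> artin_eq M (u ++ v) (u' ++ v').
Proof.
move=> /(artin_eq_ctx [::] v) h1 /(artin_eq_ctx u' [::]); rewrite !cats0.
exact: ae_trans h1.
Qed.

Lemma artin_eq_alt u u' v v' n : artin_eq M u u' -> artin_eq M v v' ->
  artin_eq M (altprod cat u v n) (altprod cat u' v' n).
Proof.
elim: n u u' v v' => [|n IH] u u' v v' hu hv; first exact: ae_refl.
by apply: artin_eq_cat => //; apply: IH.
Qed.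

Definition word_inv w : word S := rev [seq (l.1, ~~ l.2) | l <- w].

Lemma word_invK w : artin_eq M (word_inv w ++ w) [::].
Proof.
elim: w => [|[a b] w IH]; first exact: ae_refl.
rewrite /word_inv /= rev_cons cat_rcons -/(word_inv w).
by have := ae_cancel M (word_inv w) w a (~~ b); rewrite negbK => /ae_trans; apply.
Qed.

Lemma word_invKr w : artin_eq M (w ++ word_inv w) [::].
Proof.
elim/last_ind: w => [|w [a b] IH]; first exact: ae_refl.
rewrite /word_inv map_rcons rev_rcons cat_rcons -/(word_inv w).
exact: ae_trans (ae_cancel M w (word_inv w) a b) IH.
Qed.

Lemma artin_eq_catI w u v : artin_eq M (w ++ u) (w ++ v) -> artin_eq M u v.
Proof.
have E z : artin_eq M (word_inv w ++ (w ++ z)) z.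
  by have := artin_eq_ctx [::] z (word_invK w); rewrite /= catA.
move=> /(artin_eq_ctx (word_inv w) [::]); rewrite !cats0 => h.
exact: ae_trans (ae_sym (E u)) (ae_trans h (E v)).
Qed.

Lemma alt_wordE s t n :
  alt_word s t n = altprod cat [:: (s, true)] [:: (t, true)] n.
Proof.
elim: n s t => // n IH s t; rewrite /= -IH /alt_word /mkseq /=.
congr (_ :: _); rewrite -[1%N]/(1 + 0)%N iotaDl -map_comp.
by apply: eq_map => i /=; rewrite if_neg.
Qed.

Lemma artin_eq_alt_dvd a b m k : a != b -> M a b = Some m -> (m %| k)%N ->
  artin_eq M (alt_word a b k) (alt_word b a k).
Proof.
move=> ab Mab /dvdnP[q ->]; rewrite !alt_wordE.
have : artin_eq M (alt_word a b m) (alt_word b a m).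
  by have := ae_rel [::] [::] ab Mab; rewrite /= !cats0.
rewrite !alt_wordE => h; elim: q => [|q IH]; first exact: ae_refl.
rewrite mulSn !altprodD; apply: artin_eq_cat h _.
by case: (odd m) => //; apply: ae_sym.
Qed.

Lemma hom_nil phi : artin_hom M phi -> artin_eq M (phi [::]) [::].
Proof.
case=> _ /(_ [::] [::]) h; apply: (@artin_eq_catI (phi [::])).
by rewrite cats0; exact: ae_sym h.
Qed.

Lemma hom_alt phi u v n : artin_hom M phi ->
  artin_eq M (phi (altprod cat u v n)) (altprod cat (phi u) (phi v) n).
Proof.
move=> hphi; elim: n u v => [|n IH] u v; first exact: hom_nil.
apply: ae_trans (hphi.2 _ _) _; apply: artin_eq_cat; [exact: ae_refl|exact: IH].
Qed.

Lemma retraction_braid X phi w a r k : is_retraction M X phi -> a \in X ->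
  artin_eq M (phi [:: (r, true)]) w -> a != r -> M a r = Some k ->
  artin_eq M (altprod cat [:: (a, true)] w k) (altprod cat w [:: (a, true)] k).
Proof.
case=> hphi [_ hX] aX hw ar Mar.
have ha : artin_eq M (phi [:: (a, true)]) [:: (a, true)].
  by apply: hX; exists [:: (a, true)]; split; [rewrite /= aX|exact: ae_refl].
have := ae_rel [::] [::] ar Mar; rewrite /= !cats0 !alt_wordE => /hphi.1 E.
apply: ae_trans (artin_eq_alt _ (ae_sym ha) (ae_sym hw)) _.
apply: ae_trans (ae_sym (hom_alt _ _ _ hphi)) _; apply: ae_trans E _.
by apply: ae_trans (hom_alt _ _ _ hphi) _; exact: artin_eq_alt.
Qed.

End Words.

(** * The reflection-like representation *)

Section Representation.
Variables (S : finType) (M : S -> S -> option nat) (c : S -> S -> R).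
Hypothesis c_diag : forall a, c a a = 0.
Hypothesis c_anti : forall a b, c b a = - c a b.
Hypothesis c_cheb : forall a b m, a != b -> M a b = Some m -> cheb (c a b) m = 0.
Hypothesis c_zero : forall a b m, a != b -> M a b = Some m -> c a b = 0 -> m = 2%N.

Implicit Types (f : S -> R) (w : word S).

(** A transvection. Words act on the right, so (f a, f b) transforms as a row vector. *)
Definition act_letter f (x : S * bool) : S -> R :=
  fun r => f r + (if x.2 then c x.1 r else - c x.1 r) * f x.1.

Definition act f w : S -> R := foldl act_letter f w.

Lemma act_ext f g w : f =1 g -> act f w =1 act g w.
Proof.
elim: w f g => [|x w IH] f g fg //=.
by apply: IH => r; rewrite /act_letter !fg.
Qed.

Lemma act_pair a b f w : a != b -> all (fun l => l.1 \in [set a; b]) w ->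
  let g := word_mat a (c a b) w in
  act f w a = f a * m11 g + f b * m21 g /\ act f w b = f a * m12 g + f b * m22 g.
Proof.
move=> ab; elim: w f => [|[x s] w IH] f; first by move=> _ /=; split; ring.
case/andP => xab /IH{}IH /=; have [-> ->] := IH (act_letter f (x, s)).
move: xab; rewrite /letter_mat /act_letter in_set2 /= => /orP[] /eqP->.
  by rewrite eqxx c_diag; case: s => /=; split; ring.
rewrite eq_sym (negbTE ab) c_diag (c_anti a b).
by case: s => /=; split; ring.
Qed.

(** The letter a fixes f a and changes f r and f b in the ratio of c a r to c a b; similarly for b.
    The combination is thus constant, and it determines f r from the coordinates a, b. *)
Lemma act_invariant a b r f w : c a b <> 0 ->
  all (fun l => l.1 \in [set a; b]) w ->
  act f w r - c a r / c a b * act f w b + c b r / c a b * act f w a =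
  f r - c a r / c a b * f b + c b r / c a b * f a.
Proof.
move=> cab; elim: w f => [|[x s] w IH] f //.
case/andP => xab /IH{}IH; rewrite [act f _]/= -/(act _ _) IH.
move: xab; rewrite /act_letter in_set2 /= => /orP[] /eqP->.
  by rewrite c_diag; case: s; field.
by rewrite c_diag (c_anti a b); case: s; field.
Qed.

Lemma act_braid a b m f : a != b -> M a b = Some m ->
  act f (alt_word a b m) =1 act f (alt_word b a m).
Proof.
move=> ab Mab r.
(* For coefficient 0 the two transvections commute. Otherwise the matrices settle the coordinates a,
   b and the invariant settles r. *)
case: (Req_dec (c a b) 0) => [c0|c0].
  have m2 := c_zero ab Mab c0; rewrite m2 /alt_word /mkseq /= /act /= /act_letter /=.
  by rewrite (c_anti a b) c0; ring.
have s1 : all (fun l => l.1 \in [set a; b]) (alt_word a b m).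
  by rewrite alt_wordE altcat_all //= ?set21 ?set22.
have s2 : all (fun l => l.1 \in [set a; b]) (alt_word b a m).
  by rewrite alt_wordE altcat_all //= ?set21 ?set22.
have E : word_mat a (c a b) (alt_word a b m) = word_mat a (c a b) (alt_word b a m).
  rewrite !alt_wordE !word_mat_alt word_mat_upper word_mat_lower 1?eq_sym //.
  exact/alt_upper_lower_comm/c_cheb.
have [ha hb] := act_pair f ab s1; have [ha' hb'] := act_pair f ab s2.
rewrite -E -ha in ha'; rewrite -E -hb in hb'.
have := act_invariant r f c0 s1; rewrite -(act_invariant r f c0 s2) ha' hb'; lra.
Qed.

Lemma act_artin u v f : artin_eq M u v -> act f u =1 act f v.
Proof.
move=> h; elim: h f => {u v} [w|u v _ IH|u v w _ IH1 _ IH2|u v a b|u v s t k st Mk] f r //.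
- by rewrite IH.
- by rewrite IH1 IH2.
- rewrite /act !foldl_cat; apply: act_ext => {}r /=.
  move: (foldl _ _ u) => g; rewrite /act_letter /= c_diag; case: b => /=; ring.
- by rewrite /act !foldl_cat; apply: act_ext => {}r; apply: act_braid.
Qed.

(** The rows of the matrix appear on acting on the indicator functions of a and b. *)
Lemma word_mat_artin a b u v : a != b ->
  all (fun l => l.1 \in [set a; b]) u -> all (fun l => l.1 \in [set a; b]) v ->
  artin_eq M u v -> word_mat a (c a b) u = word_mat a (c a b) v.
Proof.
move=> ab su sv uv; have ba : b == a = false by rewrite eq_sym (negbTE ab).
pose f1 x : R := if x == a then 1 else 0; pose f2 x : R := if x == b then 1 else 0.
have [] := act_pair f1 ab su; have [] := act_pair f2 ab su.
rewrite !(act_artin _ uv).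
have [-> ->] := act_pair f1 ab sv; have [-> ->] := act_pair f2 ab sv.
rewrite /f1 /f2 !eqxx ba (negbTE ab).
case: (word_mat _ _ u) => ????; case: (word_mat _ _ v) => ???? /= *.
by congr Mat; lra.
Qed.

(** When c a b = 0 the matrices of words in a, b are trivial, but such words still translate the
    coordinate r, by this additive amount. *)
Definition shift_at r f w : R :=
  foldr (fun x z => (if x.2 then c x.1 r else - c x.1 r) * f x.1 + z) 0 w.

Lemma act_commuting a b r f w : c a b = 0 ->
  all (fun l => l.1 \in [set a; b]) w -> act f w r = f r + shift_at r f w.
Proof.
move=> cab; have cba : c b a = 0 by rewrite c_anti cab Ropp_0.
elim: w f => [|[x s] w IH] f; first by move=> _ /=; ring.
case/andP => xab h; rewrite /= -/(act _ _) IH //.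
have fx z : z \in [set a; b] -> act_letter f (x, s) z = f z.
  move: xab; rewrite /act_letter !in_set2 /=.
  by case/orP => /eqP->; case/orP => /eqP->; rewrite ?c_diag ?cab ?cba; case: s; ring.
have -> : shift_at r (act_letter f (x, s)) w = shift_at r f w.
  elim: w h {IH} => //= y w IH /andP[/fx -> h]; rewrite IH //.
by rewrite {1}/act_letter /=; ring.
Qed.

Lemma shift_at_cat r f u v : shift_at r f (u ++ v) = shift_at r f u + shift_at r f v.
Proof. by elim: u => [|x u IH] /=; rewrite ?IH; ring. Qed.

Lemma shift_at_alt r f u v n : shift_at r f (altprod cat u v n) =
  INR (uphalf n) * shift_at r f u + INR n./2 * shift_at r f v.
Proof.
elim: n u v => [|n IH] u v; first by rewrite /=; ring.
rewrite -[LHS]/(shift_at r f (u ++ altprod cat v u n)) shift_at_cat IH.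
have -> : uphalf n.+1 = n./2.+1 by [].
have -> : n.+1./2 = uphalf n by rewrite uphalfE.
by rewrite S_INR; ring.
Qed.

(** One side has (k + 1) / 2 copies of u and (k - 1) / 2 of v, the other side the reverse. *)
Lemma shift_at_braid a b r f u v k : odd k -> c a b = 0 ->
  all (fun l => l.1 \in [set a; b]) u -> all (fun l => l.1 \in [set a; b]) v ->
  artin_eq M (altprod cat u v k) (altprod cat v u k) ->
  shift_at r f u = shift_at r f v.
Proof.
move=> ok cab su sv E.
have := act_artin f E r; rewrite !(act_commuting _ _ cab) ?altcat_all // !shift_at_alt.
rewrite uphalf_half ok add1n S_INR; lra.
Qed.

End Representation.

(** * Triangles with an odd label *)

Definition label_weight (o : option nat) : R :=
  if o is Some m then 2 * cos (PI / INR m) else 2.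

(* Divisibility of labels, where infinity is a multiple of everything. *)
Definition label_dvd (m n : option nat) : bool :=
  if n is Some n' then if m is Some m' then m' %| n' else false else true.

Definition label_gt2 (o : option nat) : bool :=
  if o is Some p then (2 < p)%N else true.

Section Coefficients.
Variables (S : finType) (M : S -> S -> option nat) (s : S).
Hypothesis hM : coxeter_matrix M.

(* Ranks [s] first, so that the entry of [coef] at [(s, t)] is nonnegative. *)
Definition gen_rank (a : S) : nat := if a == s then 0%N else (enum_rank a).+1.

Definition coef (a b : S) : R :=
  if a == b then 0
  else if (gen_rank a < gen_rank b)%N then label_weight (M a b)
  else - label_weight (M a b).

Lemma gen_rank_inj : injective gen_rank.
Proof.
move=> a b; rewrite /gen_rank; case: eqP => [->|_]; case: eqP => [->|_] //.
by move=> [] /ord_inj/enum_rank_inj.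
Qed.

Lemma coef_diag a : coef a a = 0.
Proof. by rewrite /coef eqxx. Qed.

Lemma coef_anti a b : coef b a = - coef a b.
Proof.
rewrite /coef eq_sym; case: (altP (a =P b)) => [_|ab]; first by rewrite Ropp_0.
rewrite (hM.2.1 b a); case: ltngtP => [||/gen_rank_inj E] //.
  by rewrite Ropp_involutive.
by rewrite E eqxx in ab.
Qed.

Lemma coef_first t : s != t -> coef s t = label_weight (M s t).
Proof.
by move=> st; rewrite /coef (negbTE st) /gen_rank eqxx eq_sym (negbTE st).
Qed.

Lemma coef_cheb a b m : a != b -> M a b = Some m -> cheb (coef a b) m = 0.
Proof.
move=> ab Mab; have m2 := hM.2.2 _ _ _ ab Mab.
rewrite /coef (negbTE ab) Mab /=; case: ifP => _; rewrite ?chebN cheb_angle0 //; ring.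
Qed.

Lemma coef_zero a b m : a != b -> M a b = Some m -> coef a b = 0 -> m = 2%N.
Proof.
move=> ab Mab; have m2 := hM.2.2 _ _ _ ab Mab.
rewrite /coef (negbTE ab) Mab /= => h; apply: cos_angle_eq0 m2 _.
by move: h; case: ifP => _; lra.
Qed.

End Coefficients.

Lemma word_mat_bound (T : eqType) (a : T) (o : option nat) w :
  label_gt2 o ->
  let y := m21 (word_mat a (label_weight o) w) in
  [\/ y = 0, 2 <= label_weight o * Rabs y
    | y ^ 2 = 1 /\ exists2 p, o = Some p & odd p].
Proof.
case: o => [p /= p3|_] /=.
  have := cusp_orbit_bound p3 (word_mat_cusp a w p3).
  by case=> [?|?|[? ?]]; [apply: Or31|apply: Or32|apply: Or33; split=> //; exists p].
have [m [n [_ ->]]] := word_mat2 a w.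
case: (Z.eq_dec n 0) => [->|n0]; [apply: Or31; ring|apply: Or32].
rewrite Rabs_mult -!abs_IZR [Z.abs 2]/=.
have : 1 <= IZR (Z.abs n) by apply: IZR_le; lia.
lra.
Qed.

Lemma label_weight_gt0 (o : option nat) :
  label_gt2 o -> 0 < label_weight o.
Proof.
case: o => [p /= p3|_] /=; last lra.
have p2 : (1 < p)%N by lia.
have := @cheb_angle_ge1 p p2 2%N p3; rewrite /=; lra.
Qed.

Lemma cheb_label_weight (o : option nat) n :
  label_gt2 o -> (0 < n)%N ->
  cheb (label_weight o) n = 0 -> label_dvd o (Some n).
Proof.
case: o => [p /= p3|_] n0 /=; last first.
  by rewrite cheb2 => /(INR_eq _ 0) E; rewrite E in n0.
by move=> h; apply: sin_mul_eq0; [lia|rewrite -cheb_cos h Rmult_0_l].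
Qed.

(** The argument is -2 cos(2 pi / p), so a zero makes p divide 2 k. *)
Lemma odd_dvd_of_cheb p k : (2 < p)%N -> odd p ->
  cheb (2 - (2 * cos (PI / INR p)) ^ 2) k = 0 -> (p %| k)%N.
Proof.
move=> p3 op; set a := PI / INR p.
have -> : 2 - (2 * cos a) ^ 2 = - (2 * cos (2 * a)) by rewrite cos_2a_cos; ring.
rewrite chebN; case/Rmult_integral => [h|h].
  by have := pow_nonzero (-1) k; lra.
have := cheb_cos (2 * a) k; rewrite h Rmult_0_l.
have -> : INR k * (2 * a) = INR (k * 2) * (PI / INR p).
  by rewrite mult_INR /a /=; ring.
move=> /esym/sin_mul_eq0-/(_ ltac:(lia)).
by rewrite Gauss_dvdl // coprime_sym coprime2n.
Qed.

Lemma odd_triangle (S : finType) (M : S -> S -> option nat) s r t k :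
  coxeter_matrix M -> parabolic_retractable M ->
  s != r -> s != t -> r != t -> M s r = Some k -> odd k ->
  label_dvd (M s t) (M r t) || label_dvd (M s t) (Some k).
Proof.
move=> hM hret sr st rt Msr ok.
case Mrt: (M r t) => [q|] //.
have [phi hphi] := hret [set s; t].
have [w [sw hw]] := hphi.2.1 [:: (r, true)].
have Es := retraction_braid hphi (set21 s t) hw sr Msr.
have Mtr : M t r = Some q by rewrite (hM.2.1 t r).
have Et := retraction_braid hphi (set22 s t) hw (contra_neq esym rt) Mtr.
have cd := coef_diag M s; have ca := coef_anti s hM.
have cc := coef_cheb s hM; have cz := @coef_zero _ _ s hM.
have ss : all (fun l => l.1 \in [set s; t]) [:: (s, true)] by rewrite /= set21.
have ts : all (fun l => l.1 \in [set s; t]) [:: (t, true)] by rewrite /= set22.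
have k2 := hM.2.2 _ _ _ sr Msr; have q2 := hM.2.2 _ _ _ rt Mrt.
case: (altP (M s t =P Some 2%N)) => [Mst|Mst].
  (* If q were odd too, s, w and t would shift the coordinate r equally. On the indicator of s this
     gives [coef M s s r = 0], hence k = 2. *)
  rewrite Mst /= dvdn2; apply/orP; left; apply/negP => oq.
  have c0 : coef M s s t = 0.
    by rewrite coef_first // Mst /= cos_PI2; ring.
  pose f x : R := if x == s then 1 else 0.
  have h1 := shift_at_braid cd ca cc cz r f ok c0 ss sw Es.
  have h2 := shift_at_braid cd ca cc cz r f oq c0 ts sw Et.
  have : coef M s s r = 0.
    move: h1; rewrite -h2 /= /f eqxx eq_sym (negbTE st); lra.
  by move=> /(cz _ _ _ sr Msr) E; rewrite E in ok.
have p3 : label_gt2 (M s t).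
  rewrite /label_gt2; case E: (M s t) => [p|] //; have := hM.2.2 _ _ _ st E.
  by move=> p2; rewrite ltn_neqAle p2 andbT; apply: contraNneq Mst => ->; rewrite E.
have cE : coef M s s t = label_weight (M s t) by rewrite coef_first.
have l0 := label_weight_gt0 p3.
have := word_mat_artin cd ca cc cz st (altcat_all k ss sw) (altcat_all k sw ss) Es.
have := word_mat_artin cd ca cc cz st (altcat_all q ts sw) (altcat_all q sw ts) Et.
have := @word_mat_bound _ s (M s t) (altprod cat [:: (s, true)] w k) p3.
rewrite cE !word_mat_alt word_mat_upper word_mat_lower 1?eq_sym //.
have dg := word_mat_det s (label_weight (M s t)) w.
move: (word_mat s _ w) dg => g dg hb e2 e1.
have [h0 h1] := braid_upper_cases (Rgt_not_eq _ _ l0) ok dg e1.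
move: hb h0 h1; set y := m21 _ => hb h0 h1.
(* If y = 0, w has the matrix of s, and its relation with t is one of length q between the two
   generators. *)
case: (Req_dec y 0) => [/h0 gE|y0].
  move: e2; rewrite gE => /esym/(alt_upper_lower_cheb0 (Rgt_not_eq _ _ l0)).
  by move=> /(cheb_label_weight p3 (ltnW q2)) ->.
(* If l |y| >= 2, the Chebyshev argument is at most -2, where there is no zero. *)
move: (h1 y0) => hk; case: hb => [//|hy|[hy [p Mst' op]]].
  case: (cheb_neq0 _ (ltnW k2) hk).
  have -> : y ^ 2 = Rabs y ^ 2 by rewrite pow2_abs.
  nra.
apply/orP; right; move: hk p3; rewrite hy Rmult_1_r Mst' /= => hk p3.
by apply: odd_dvd_of_cheb p3 op _; rewrite -hk /=.
Qed.

Local Close Scope R_scope.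

(** * Nearest-point projections *)

Section Nearest.
Variables (S : finType) (M : S -> S -> option nat).
Hypothesis hM : coxeter_matrix M.

Definition odd_label (s t : S) : bool := if M s t is Some k then odd k else false.

Hypothesis triangle : forall s r t, odd_label s r ->
  label_dvd (M s t) (M r t) || label_dvd (M s t) (M s r).

(** Compared only within an odd class, where labels are finite; a point is at distance 1 from
    itself. *)
Let dist (s t : S) : nat := odflt 0 (M s t).

Lemma odd_labelxx s : odd_label s s.
Proof. by rewrite /odd_label hM.1. Qed.

Lemma odd_labelC s t : odd_label s t = odd_label t s.
Proof. by rewrite /odd_label hM.2.1. Qed.

Lemma odd_label_dist s t : odd_label s t -> M s t = Some (dist s t) /\ odd (dist s t).
Proof. by rewrite /odd_label /dist; case: (M s t). Qed.

Lemma distC s t : dist s t = dist t s.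
Proof. by rewrite /dist hM.2.1. Qed.

Lemma label_dvd_odd s t k : odd k -> label_dvd (M s t) (Some k) -> odd_label s t.
Proof. by rewrite /odd_label /label_dvd => ok; case: (M s t) => // m /dvdn_odd; apply. Qed.

Lemma odd_label_trans s r t : odd_label s r -> odd_label r t -> odd_label s t.
Proof.
move=> sr rt; have [Er or] := odd_label_dist sr; have [Et ot] := odd_label_dist rt.
by have := triangle t sr; rewrite Er Et => /orP[] /label_dvd_odd; apply.
Qed.

(** A label to another class cannot divide the odd m_(s,r), so the labels from s and r divide each
    other. *)
Lemma even_label_eq s r t : odd_label s r -> ~~ odd_label s t -> M s t = M r t.
Proof.
have half x y z : odd_label x y -> ~~ odd_label x z -> label_dvd (M x z) (M y z).
  move=> xy xz; have [E oE] := odd_label_dist xy.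
  by have := triangle z xy => /orP[] //; rewrite E => /(label_dvd_odd oE); rewrite (negbTE xz).
move=> sr st; have h1 := half _ _ _ sr st.
have rt : ~~ odd_label r t by apply: contra st => /(odd_label_trans sr).
have h2 : label_dvd (M r t) (M s t) by apply: half rt; rewrite odd_labelC.
move: h1 h2; rewrite /label_dvd; case: (M s t) => [m|]; case: (M r t) => [n|] //.
by move=> h1 h2; congr Some; apply/eqP; rewrite eqn_dvd h1.
Qed.

Lemma dist_ultra x y z : odd_label x y -> odd_label y z ->
  (dist x z %| dist x y) || (dist x z %| dist y z).
Proof.
move=> xy yz; have [Exy _] := odd_label_dist xy; have [Eyz _] := odd_label_dist yz.
have [Exz _] := odd_label_dist (odd_label_trans xy yz).
by have := triangle z xy; rewrite Exy Eyz Exz /= orbC.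
Qed.

(** Each side of a triangle divides one of the other two, so any two sides are comparable for
    divisibility. *)
Lemma dist_le_dvd x y z : odd_label x y -> odd_label x z ->
  dist x y <= dist x z -> dist x y %| dist x z.
Proof.
move=> xy xz le.
have yx : odd_label y x by rewrite odd_labelC.
have zx : odd_label z x by rewrite odd_labelC.
have yz := odd_label_trans yx xz.
have zy : odd_label z y by rewrite odd_labelC.
have oy := (odd_label_dist xy).2.
have := dist_ultra xz zy; have := dist_ultra xy yz; have := dist_ultra yx xz.
rewrite (distC y x) (distC z y).
move=> h1 h2 /orP[//|h3].
case/orP: h1 => h1; last exact: dvdn_trans h3 h1.
have zxy : dist x z %| dist x y by case/orP: h2 => // h2; apply: dvdn_trans h2 h1.
have := dvdn_leq (odd_gt0 oy) zxy => le'.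
by rewrite (@anti_leq (dist x y) (dist x z)) ?le.
Qed.

Definition nearest (X : {set S}) (y x : S) : bool :=
  [&& x \in X, odd_label y x &
      [forall x' in X, odd_label y x' ==> (dist y x <= dist y x')]].

(** [pick] depends only on the predicate: elements with the same nearest points get the same
    image. *)
Definition proj (X : {set S}) (y : S) : option S := [pick x | nearest X y x].

Lemma nearestP X y x : nearest X y x ->
  [/\ x \in X, odd_label y x
    & forall x', x' \in X -> odd_label y x' -> dist y x %| dist y x'].
Proof.
case/and3P => xX yx /forall_inP H; split=> // x' x'X yx'.
by apply: dist_le_dvd => //; apply: (implyP (H x' x'X)).
Qed.

Lemma proj_some X y x : proj X y = Some x -> nearest X y x.
Proof. by rewrite /proj; case: pickP => // z h [<-]. Qed.

Lemma proj_none (X : {set S}) y x : proj X y = None -> x \in X -> ~~ odd_label y x.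
Proof.
rewrite /proj; case: pickP => // h _ xX; apply/negP => yx.
pose P z := (z \in X) && odd_label y z.
have Px : P x by rewrite /P xX.
case: (arg_minnP (dist y) Px) => z /andP[zX yz] zmin.
have := h z; rewrite /nearest zX yz /= => /negbT/forall_inPn[u uX].
by rewrite negb_imply => /andP[yu]; rewrite zmin ?/P ?uX.
Qed.

Lemma proj_id (X : {set S}) x : x \in X -> proj X x = Some x.
Proof.
move=> xX; case E: (proj X x) => [z|]; last first.
  by have := proj_none E xX; rewrite odd_labelxx.
have [zX xz /(_ x xX (odd_labelxx x))] := nearestP (proj_some E).
rewrite {2}/dist hM.1 /= dvdn1 => /eqP d1.
case: (altP (x =P z)) => [->//|xz'].
by have := hM.2.2 _ _ _ xz' (odd_label_dist xz).1; rewrite d1.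
Qed.

Lemma proj_braid X y z k : M y z = Some k ->
  match proj X y, proj X z with
  | Some a, Some b => a = b \/ exists2 m, M a b = Some m & m %| k
  | None, None => True
  | _, _ => ~~ odd k
  end.
Proof.
move=> Myz.
have oddE : odd_label y z = odd k by rewrite /odd_label Myz.
case Ey: (proj X y) => [a|]; case Ez: (proj X z) => [b|] //; last first.
- apply/negP => ok; have [bX zb _] := nearestP (proj_some Ez).
  have := proj_none Ey bX; rewrite (odd_label_trans _ zb) //.
  by rewrite oddE.
- apply/negP => ok; have [aX ya _] := nearestP (proj_some Ey).
  have := proj_none Ez aX; rewrite (odd_label_trans _ ya) //.
  by rewrite odd_labelC oddE.
have [aX ya amin] := nearestP (proj_some Ey).
have [bX zb bmin] := nearestP (proj_some Ez).
(* For even k, y and z lie in different classes, and passing to their classmates a and b keeps the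
   label. *)
have [ok|ek] := boolP (odd k); last first.
  right; exists k => //; rewrite -Myz.
  have yz : ~~ odd_label y z by rewrite oddE.
  rewrite (even_label_eq ya yz) hM.2.1.
  rewrite [in RHS]hM.2.1; symmetry; apply: even_label_eq => //.
  rewrite odd_labelC; apply: contra yz => az; exact: odd_label_trans az.
have yz : odd_label y z by rewrite oddE.
have zy : odd_label z y by rewrite odd_labelC.
have dk : dist y z = k by rewrite /dist Myz.
have dk' : dist z y = k by rewrite distC.
(* The distance from v to a' divides k by the ultrametric inequality, hence so does that from v to
   its nearest point b', and then that from a' to b'. *)
have close u v a' b' : odd_label u v -> odd_label u a' -> odd_label v b' ->
    dist u v = k -> a' \in X ->
    (forall x', x' \in X -> odd_label v x' -> dist v b' %| dist v x') ->
    dist u a' %| k -> exists2 m, M a' b' = Some m & m %| k.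
  move=> uv ua vb uvk a'X vmin dua.
  have vu : odd_label v u by rewrite odd_labelC.
  have va := odd_label_trans vu ua; have av : odd_label a' v by rewrite odd_labelC.
  have dva : dist v a' %| k.
    have := dist_ultra vu ua; rewrite (distC v u) uvk => /orP[//|h].
    exact: dvdn_trans h dua.
  have dvb := dvdn_trans (vmin _ a'X va) dva.
  exists (dist a' b'); first exact: (odd_label_dist (odd_label_trans av vb)).1.
  by have := dist_ultra av vb; rewrite (distC a' v) => /orP[] h; apply: dvdn_trans h _.
have [dya|dya] := boolP (dist y a %| k).
  right; exact: (close y z a b).
have [dzb|dzb] := boolP (dist z b %| k).
  right; rewrite hM.2.1; exact: (close z y b a).
(* Both nearest points are farther than [k]: then [y] and [z] are equidistant
   from every point of [X] and [pick] makes the same choice. *)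
left; have yzE x : odd_label y x = odd_label z x.
  by apply/idP/idP => h; [exact: odd_label_trans zy h|exact: odd_label_trans yz h].
(* If the distance from u to x divided k, so would the one to the nearest point a'. *)
have half u v a' x : odd_label u v -> odd_label u x -> odd_label v x ->
    dist u v = k -> x \in X -> ~~ (dist u a' %| k) ->
    (forall x', x' \in X -> odd_label u x' -> dist u a' %| dist u x') ->
    dist u x %| dist v x.
  move=> uv ux vx uvk xX nk umin; case/orP: (dist_ultra uv vx) => //.
  by rewrite uvk => /(dvdn_trans (umin _ xX ux)); rewrite (negbTE nk).
have dE x : x \in X -> odd_label y x -> dist y x = dist z x.
  move=> xX yx; have zx : odd_label z x by rewrite -yzE.
  apply/eqP; rewrite eqn_dvd (half y z a) //=.
  exact: (half z y b).
have nE : nearest X y =1 nearest X z.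
  move=> x; rewrite /nearest -yzE; case xX: (x \in X) => //=.
  case yx: (odd_label y x) => //=; apply: eq_forallb_in => x' x'X.
  by rewrite -yzE; case yx': (odd_label y x') => //=; rewrite !dE.
by move: Ey Ez; rewrite /proj (eq_pick nE) => -> [].
Qed.

End Nearest.

(** * Homomorphisms defined on generators, and the ordinary retraction *)

Section Ordinary.
Variables (S : finType) (M : S -> S -> option nat) (h : S -> word S).

Definition subst_word (w : word S) : word S :=
  flatten [seq if l.2 then h l.1 else word_inv (h l.1) | l <- w].

Lemma subst_word_cat u v : subst_word (u ++ v) = subst_word u ++ subst_word v.
Proof. by rewrite /subst_word map_cat flatten_cat. Qed.

Lemma subst_word_alt s t n :
  subst_word (alt_word s t n) = altprod cat (h s) (h t) n.
Proof.
rewrite alt_wordE (altprod_morph _ _ _ _ subst_word_cat) // /subst_word /=.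
by rewrite !cats0.
Qed.

Lemma subst_word_hom :
  (forall s t k, s != t -> M s t = Some k ->
     artin_eq M (altprod cat (h s) (h t) k) (altprod cat (h t) (h s) k)) ->
  artin_hom M subst_word.
Proof.
move=> hrel; split=> u v; last by rewrite subst_word_cat; exact: ae_refl.
elim=> {u v} [w|u v _ IH|u v w _ IH1 _ IH2|u v a b|u v s t k st Mk].
- exact: ae_refl.
- exact: ae_sym.
- exact: ae_trans IH1 IH2.
- rewrite !subst_word_cat; apply: (artin_eq_ctx _ _ (v := [::])).
  rewrite /subst_word /= cats0; case: b => /=; [exact: word_invKr|exact: word_invK].
- rewrite !subst_word_cat; apply: artin_eq_ctx; rewrite !subst_word_alt.
  exact: hrel st Mk.
Qed.

End Ordinary.

Theorem theorem1p3 (S : finType) (M : S -> S -> option nat)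
  (hM : coxeter_matrix M) (hret : parabolic_retractable M) (X : {set S}) :
  exists phi : word S -> word S, ordinary_retraction M X phi.
Proof.
(* Coinciding elements make the divisibility immediate, as m_(s,s) = 1. *)
have tri s r t : odd_label M s r ->
    label_dvd (M s t) (M r t) || label_dvd (M s t) (M s r).
  case: (altP (s =P r)) => [->|sr]; first by rewrite /label_dvd; case: (M r t) => // m; rewrite dvdnn.
  case: (altP (s =P t)) => [->|st].
    by rewrite hM.1 /label_dvd; case: (M r t) => // m; rewrite dvd1n.
  case: (altP (r =P t)) => [->|rt].
    by rewrite /label_dvd orbC; case: (M s t) => // m; rewrite dvdnn.
  rewrite /odd_label; case Msr: (M s r) => [k|] // ok.
  exact: odd_triangle hM hret sr st rt Msr ok.
pose h y : word S := if proj M X y is Some x then [:: (x, true)] else [::].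
have hx x : x \in X -> h x = [:: (x, true)] by move=> xX; rewrite /h proj_id.
have hrel s t k : s != t -> M s t = Some k ->
    artin_eq M (altprod cat (h s) (h t) k) (altprod cat (h t) (h s) k).
  move=> st Mst; have := proj_braid hM tri X Mst; rewrite /h.
  (* Both sides consist of k / 2 copies of u. *)
  have even_nil (u : word S) : ~~ odd k ->
      altprod cat u [::] k = altprod cat [::] u k.
    move=> ek; have -> : k = k./2 + k./2 by rewrite addnn even_halfK.
    by rewrite !altprod_double /= cats0.
  case: (proj M X s) => [a|]; case: (proj M X t) => [b|].
  - case: (altP (a =P b)) => [-> _|ab]; first exact: ae_refl.
    case=> [E|[m Mab mk]]; first by rewrite E eqxx in ab.
    by rewrite -!alt_wordE; apply: artin_eq_alt_dvd Mab mk.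
  - by move=> ek; rewrite even_nil //; exact: ae_refl.
  - by move=> ek; rewrite even_nil //; exact: ae_refl.
  - by move=> _; exact: ae_refl.
have hhom := subst_word_hom hrel.
have hsupp y : all (fun l => l.1 \in X) (h y).
  rewrite /h; case E: (proj M X y) => [x|] //=.
  by have [-> _ _] := nearestP hM tri (proj_some E).
have single y : subst_word h [:: (y, true)] = h y by rewrite /subst_word /= cats0.
exists (subst_word h); split; [split=> //; split|split].
- move=> w; exists (subst_word h w); split; last exact: ae_refl.
  elim: w => [|[y b] w IH] //=; rewrite /subst_word /= all_cat -/(subst_word h w) IH andbT.
  case: b => //=; rewrite /word_inv all_rev all_map.
  by apply: sub_all (hsupp y).
- move=> w [w' [sw' ww']]; apply: ae_trans (hhom.1 _ _ ww') _.
  suff -> : subst_word h w' = w' by exact: ae_sym.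
  elim: w' sw' {ww'} => [|[y b] w' IH] //= /andP[yX /IH E].
  by rewrite /subst_word /= -/(subst_word h w') E hx //; case: b.
- by move=> x xX; rewrite single hx //; exact: ae_refl.
- move=> y yX; rewrite single /h; case E: (proj M X y) => [x|]; [left|right; exact: ae_refl].
  exists x; last exact: ae_refl.
  by have [] := nearestP hM tri (proj_some E).
Qed.
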